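(* Let $k$ be a field of characteristic $p>0$. The conjugacy classes of $\mathrm{BAs}_2(k)$ in $\mathrm{BA}_2(k)$ are those of (1) $(x,y)$; (2) $(x,y+1)$; (3) $(x+f(y),y)$ where $f\in k[y]$ is nonzero and monic, and is a unique representative in $k[y]$ under the action $\mathrm{GA}_1(k)\times k[y]\to k[y]$ given by $(\mu y+\lambda)\cdot g(y)=g(\mu y+\lambda)$; (4) $(x+y^{p-1}f(y^p),y+1)$ where $f\neq0$ is a monic one-variable polynomial over $k$.
   Context: $\mathrm{BA}_2(k)$ is the group (under composition) of triangular polynomial automorphisms $(ax+f,by+c)$ with $a,b\in k^*$, $f\in k[y]$, $c\in k$; $\mathrm{BAs}_2(k)$ is its subgroup of maps with $a=b=1$. The conjugacy classes of $\mathrm{BAs}_2(k)$ in $\mathrm{BA}_2(k)$ are the classes of elements of $\mathrm{BAs}_2(k)$ under the relation $G=HFH^{-1}$ for some $H\in\mathrm{BA}_2(k)$. $\mathrm{GA}_1(k)=\{\mu y+\lambda : \mu\in k^*,\lambda\in k\}$. ''A unique representative under the action'' means that a system of representatives is chosen once and for all and $f$ is required to lie in it.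
   Formalization: The chosen system of representatives is assumed to contain a monic element of each GA_1(k)-orbit that has one; otherwise the claim fails (over F_3, choosing 2y for the orbit of degree-1 polynomials misses the class of (x+y,y)). *)

(* Defs.v *)
From HB Require Import structures.
From mathcomp Require Import all_boot all_order all_algebra.
From mathcomp Require Import mpoly.

Set Implicit Arguments.
Unset Strict Implicit.
Unset Printing Implicit Defensive.

Import GRing.Theory.
Local Open Scope ring_scope.

Section TriangularAutomorphisms.
Variable k : fieldType.

(* A polynomial endomorphism of the affine plane, given by its two components
   in k[x, y]. *)
Definition polymap := (2.-tuple {mpoly k[2]})%type.

Definition varx : {mpoly k[2]} := 'X_(ord0 : 'I_2).
Definition vary : {mpoly k[2]} := 'X_(ord_max : 'I_2).

Definition pm (P Q : {mpoly k[2]}) : polymap := [tuple P; Q].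

Definition pm_id : polymap := pm varx vary.

(* F o G : the components of G are substituted for the variables of F. *)
Definition pm_comp (F G : polymap) : polymap :=
  [tuple (tnth F i) \mPo G | i < 2].

(* The image f(y) in k[x, y] of a one-variable polynomial f. *)
Definition in_y (f : {poly k}) : {mpoly k[2]} :=
  (map_poly (@mpolyC 2 k) f).[vary].

Definition BA2 (F : polymap) : Prop :=
  exists (a b c : k) (f : {poly k}),
    [/\ a != 0, b != 0 & F = pm (a *: varx + in_y f) (b *: vary + c%:MP)].

Definition BAs2 (F : polymap) : Prop :=
  exists (c : k) (f : {poly k}), F = pm (varx + in_y f) (vary + c%:MP).

(* G = H o F o H^-1 for some H in BA_2(k); Hinv is the inverse of H. *)
Definition BA2_conj (F G : polymap) : Prop :=
  exists H Hinv : polymap,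
    [/\ BA2 H, BA2 Hinv, pm_comp H Hinv = pm_id, pm_comp Hinv H = pm_id
      & G = pm_comp (pm_comp H F) Hinv].

Definition conj_class (F G : polymap) : Prop := BAs2 G /\ BA2_conj F G.

Definition GA1 (l : {poly k}) : Prop :=
  exists mu lambda : k, mu != 0 /\ l = mu *: 'X + lambda%:P.

(* h lies in the orbit of g under (mu y + lambda) . g(y) = g(mu y + lambda). *)
Definition GA1_orbit (g h : {poly k}) : Prop :=
  exists2 l : {poly k}, GA1 l & h = g \Po l.

Definition GA1_representatives (R : {poly k} -> Prop) : Prop :=
  forall g : {poly k}, exists! f : {poly k}, R f /\ GA1_orbit g f.

(* GA_1(k) does not preserve monicity, so an arbitrary system of
   representatives may pick a non-monic element in an orbit that contains
   monic ones; this condition rules that out. *)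
Definition monic_whenever_possible (R : {poly k} -> Prop) : Prop :=
  forall f g : {poly k},
    R f -> GA1_orbit f g -> g \is monic -> f \is monic.

Inductive normal_form (p : nat) (R : {poly k} -> Prop) :
    nat -> polymap -> Prop :=
| NF1 : normal_form p R 1 (pm varx vary)
| NF2 : normal_form p R 2 (pm varx (vary + 1))
| NF3 (f : {poly k}) : f != 0 -> f \is monic -> R f ->
    normal_form p R 3 (pm (varx + in_y f) vary)
| NF4 (f : {poly k}) : f != 0 -> f \is monic ->
    normal_form p R 4
      (pm (varx + in_y ('X^(p.-1) * (f \Po 'X^p))) (vary + 1)).

End TriangularAutomorphisms.

(* Main.v *)
(** For [H = (ax + g(y), by + c)], comparing [H o F] with [G o H] shows that
    [(x + f(y), y + d)] and [(x + f'(y), y + d')] are conjugate exactly when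
    [d' = b d] and [a f(y) + g(y + d) = g(y) + f'(by + c)] are solvable.
    For [d = 0] this says that [f] and [f'] agree up to scaling and the action
    of GA_1.  For [d = 1] it involves the difference operator
    [g |-> g(y + 1) - g(y)], and [k[y]] is the direct sum of its image and of
    the polynomials [y^(p-1) h(y^p)]: the degree of a nonzero difference is
    never congruent to [p - 1] modulo [p], every other degree occurs, and the
    degrees congruent to [p - 1] are those of the polynomials
    [y^(p-1) h(y^p)]. *)

Require Import Defs.
From mathcomp Require Import all_boot all_order all_algebra.
From mathcomp Require Import mpoly.
From mathcomp Require Import ring.

Import GRing.Theory.
Local Open Scope ring_scope.

(** * Triangular maps: composition, inverses and the conjugacy equation *)

Section Triangular.
Context {k : fieldType}.
Implicit Types (a b c d : k) (f g h : {poly k}) (P : {mpoly k[2]}).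
Implicit Types F G H : polymap k.

Definition aff b c : {poly k} := b *: 'X + c%:P.

Definition tri a f b c : polymap k :=
  pm (a *: varx k + in_y f) (b *: vary k + c%:MP).

Lemma aff10 : aff 1 0 = 'X.
Proof. by rewrite /aff scale1r addr0. Qed.

Lemma aff_comp b c b' c' : aff b c \Po aff b' c' = aff (b * b') (b * c' + c).
Proof.
rewrite /aff comp_polyD comp_polyZ comp_polyX comp_polyC scalerDr scalerA.
by rewrite polyCD polyCM mul_polyC addrA.
Qed.

Lemma aff_comp_inv b c : b != 0 -> aff b c \Po aff b^-1 (- (b^-1 * c)) = 'X.
Proof. by move=> b0; rewrite aff_comp mulrN mulVKf // divff // addNr aff10. Qed.

Lemma aff_inv_comp b c : b != 0 -> aff b^-1 (- (b^-1 * c)) \Po aff b c = 'X.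
Proof. by move=> b0; rewrite aff_comp mulVf // subrr aff10. Qed.

Lemma in_yE f : in_y f = horner_morph (fun c => mulrC (vary k) c%:MP) f.
Proof. by []. Qed.

Lemma in_y0 : in_y (0 : {poly k}) = 0.
Proof. by rewrite in_yE rmorph0. Qed.

Lemma in_yD f g : in_y (f + g) = in_y f + in_y g.
Proof. by rewrite in_yE rmorphD. Qed.

Lemma in_yC c : in_y c%:P = c%:MP.
Proof. by rewrite in_yE horner_morphC. Qed.

Lemma in_yX : in_y 'X = vary k.
Proof. by rewrite in_yE horner_morphX. Qed.

Lemma in_yM f g : in_y (f * g) = in_y f * in_y g.
Proof. by rewrite in_yE rmorphM. Qed.

Lemma in_yZ c f : in_y (c *: f) = c *: in_y f.
Proof. by rewrite -mul_polyC in_yM in_yC mul_mpolyC. Qed.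

Lemma in_y_aff b c : in_y (aff b c) = b *: vary k + c%:MP.
Proof. by rewrite in_yD in_yZ in_yX in_yC. Qed.

Lemma varx_comp F : varx k \mPo F = tnth F ord0.
Proof. by rewrite comp_mpolyXU -tnth_nth. Qed.

Lemma vary_comp F : vary k \mPo F = tnth F ord_max.
Proof. by rewrite comp_mpolyXU -tnth_nth. Qed.

(** As [in_y f] does not involve x, only the second component of [F] enters. This turns composition
    of plane maps into composition in k[y]. *)
Lemma in_y_comp f g F :
  tnth F ord_max = in_y g -> in_y f \mPo F = in_y (f \Po g).
Proof.
move=> Fg; elim/poly_ind: f => [|f c IHf].
  by rewrite comp_poly0 in_y0 comp_mpoly0.
rewrite comp_poly_MXaddC !in_yD !in_yM !in_yC in_yX rmorphD rmorphM /=.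
by rewrite comp_mpolyC IHf vary_comp Fg.
Qed.

Lemma pm_eq F G :
  tnth F ord0 = tnth G ord0 -> tnth F ord_max = tnth G ord_max -> F = G.
Proof.
move=> e0 e1; apply: eq_from_tnth => -[[|[|//]] ltj].
  by rewrite (_ : Ordinal ltj = ord0) //; apply: val_inj.
by rewrite (_ : Ordinal ltj = ord_max) //; apply: val_inj.
Qed.

Lemma pm_compA F G H : pm_comp (pm_comp F G) H = pm_comp F (pm_comp G H).
Proof.
apply: eq_from_tnth => j; rewrite !tnth_mktuple.
(* Substitution is a ring morphism, so it suffices to compare the two sides on each monomial of the
   component of [F]. *)
rewrite (comp_mpolyEX (tnth F j)) rmorph_sum [RHS]comp_mpolyEX.
apply: eq_bigr => m _ /=.
rewrite comp_mpolyZ !comp_mpolyX rmorph_prod; congr (_ *: _).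
by apply: eq_bigr => i _ /=; rewrite rmorphXn tnth_mktuple.
Qed.

Lemma pm_comp_idl F : pm_comp (pm_id k) F = F.
Proof.
by apply: pm_eq; rewrite tnth_mktuple ?[LHS]varx_comp ?[LHS]vary_comp.
Qed.

Lemma pm_comp_idr F : pm_comp F (pm_id k) = F.
Proof.
have -> : pm_id k = [tuple 'X_i | i < 2] by apply: pm_eq; rewrite tnth_mktuple.
by apply: eq_from_tnth => j; rewrite tnth_mktuple comp_mpoly_id.
Qed.

Lemma tnth_tri0 a f b c : tnth (tri a f b c) ord0 = a *: varx k + in_y f.
Proof. by []. Qed.

Lemma tnth_tri_max a f b c : tnth (tri a f b c) ord_max = in_y (aff b c).
Proof. by rewrite in_y_aff. Qed.

Lemma tri_comp a f b c a' f' b' c' :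
  pm_comp (tri a f b c) (tri a' f' b' c') =
  tri (a * a') (a *: f' + (f \Po aff b' c')) (b * b') (b * c' + c).
Proof.
apply: pm_eq; rewrite tnth_mktuple.
  rewrite !tnth_tri0 comp_mpolyD comp_mpolyZ varx_comp tnth_tri0.
  rewrite (in_y_comp _ _ _ (tnth_tri_max _ _ _ _)).
  by rewrite scalerDr scalerA in_yD in_yZ addrA.
by rewrite !tnth_tri_max (in_y_comp _ _ _ (tnth_tri_max _ _ _ _)) aff_comp.
Qed.

Lemma tri_id : tri 1 0 1 0 = pm_id k.
Proof. by rewrite /tri in_y0 !scale1r !addr0. Qed.

(* Substituting a constant for [x] and the variable for [y] recovers all the
   data of a triangular map. *)
Definition restrict_x u : {mpoly k[2]} -> {poly k} :=
  mmap polyC (fun i : 'I_2 => if i == ord0 then u%:P else 'X).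

Lemma restrict_x_in_y u f : restrict_x u (in_y f) = f.
Proof.
elim/poly_ind: f => [|f c IHf]; first by rewrite in_y0 [LHS]mmap0.
rewrite in_yD in_yM in_yC in_yX /restrict_x mmapD rmorphM /= mmapC.
by rewrite -/(restrict_x u) IHf [restrict_x u _]mmapX mmap1U.
Qed.

Lemma restrict_x_varx u : restrict_x u (varx k) = u%:P.
Proof. by rewrite [LHS]mmapX mmap1U. Qed.

Lemma tri_inj a f b c a' f' b' c' :
  tri a f b c = tri a' f' b' c' -> [/\ a = a', f = f', b = b' & c = c'].
Proof.
move=> e; have := congr1 (fun F : polymap k => tnth F ord0) e.
rewrite !tnth_tri0 => ex.
have := congr1 (fun F : polymap k => tnth F ord_max) e.
rewrite !tnth_tri_max => /(congr1 (restrict_x 0)).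
rewrite !restrict_x_in_y => ey.
(* Two values of [u] suffice: [u = 0] isolates the polynomial parts, after which [u = 1] isolates
   the scalars. *)
have r u : (a * u)%:P + f = (a' * u)%:P + f'.
  have := congr1 (restrict_x u) ex.
  by rewrite /restrict_x !mmapD !mmapZ -!/(restrict_x u) !restrict_x_in_y
     restrict_x_varx !polyCM.
have := r 0; rewrite !mulr0 !add0r => ef.
have := r 1; rewrite !mulr1 ef => /addIr/polyC_inj ea.
have cf n := congr1 (fun q : {poly k} => q`_n) ey.
have := cf 0%N; have := cf 1%N.
by rewrite !coefD !coefZ !coefX !coefC /= !mulr1 !mulr0 !addr0 !add0r.
Qed.

Lemma BA2P H : BA2 H <->
  exists a b c f, [/\ a != 0, b != 0 & H = tri a f b c].
Proof. by []. Qed.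

Lemma BAs2P F : BAs2 F <-> exists d f, F = tri 1 f 1 d.
Proof. by split=> -[d [f ->]]; exists d, f; rewrite /tri !scale1r. Qed.

Lemma BA2_comp G H : BA2 G -> BA2 H -> BA2 (pm_comp G H).
Proof.
move=> /BA2P[a [b [c [f [a0 b0 ->]]]]] /BA2P[a' [b' [c' [f' [a0' b0' ->]]]]].
apply/BA2P; exists (a * a'), (b * b'), (b * c' + c).
exists (a *: f' + (f \Po aff b' c')).
by rewrite !mulf_neq0 // tri_comp.
Qed.

Lemma BA2_conj_sym F G : BA2_conj F G -> BA2_conj G F.
Proof.
move=> [H [H' [BH BH' HH' H'H ->]]]; exists H', H; split=> //.
by rewrite !pm_compA H'H pm_comp_idr -pm_compA H'H pm_comp_idl.
Qed.

Lemma BA2_conj_trans F G H : BA2_conj F G -> BA2_conj G H -> BA2_conj F H.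
Proof.
move=> [U [U' [BU BU' UU' U'U ->]]] [V [V' [BV BV' VV' V'V ->]]].
exists (pm_comp V U), (pm_comp U' V'); split; try exact: BA2_comp.
- by rewrite pm_compA -(pm_compA U) UU' pm_comp_idl.
- by rewrite pm_compA -(pm_compA V') V'V pm_comp_idl.
- by rewrite !pm_compA.
Qed.

(** Solving X = ax + f(y), Y = by + c gives y = l(Y) and then x = (X - f(l(Y)))/a, which is [H']. *)
Lemma tri_inverse a f b c (a0 : a != 0) (b0 : b != 0)
    (l := aff b^-1 (- (b^-1 * c)))
    (H := tri a f b c)
    (H' := tri a^-1 (- (a^-1 *: (f \Po l))) b^-1 (- (b^-1 * c))) :
  pm_comp H H' = pm_id k /\ pm_comp H' H = pm_id k.
Proof.
rewrite /H /H' !tri_comp -/l -tri_id !divff // !mulVf // mulrN mulVKf //.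
rewrite addNr subrr scalerN scalerA divff // scale1r addNr; split=> //.
rewrite -scaleN1r comp_polyZ comp_polyZ scaleN1r -comp_polyA aff_inv_comp //.
by rewrite comp_polyXr subrr.
Qed.

(* The equation [H o F = G o H] for [H = tri a g b c], coefficient by
   coefficient. *)
Lemma BA2_conj_tri f d f' d' :
  BA2_conj (tri 1 f 1 d) (tri 1 f' 1 d') <->
  exists a b c g, [/\ a != 0, b != 0, d' = b * d
    & a *: f + (g \Po ('X + d%:P)) = g + (f' \Po aff b c)].
Proof.
have aff1 : 'X + d%:P = aff 1 d by rewrite /aff scale1r.
split=> [[H [H' [/BA2P[a [b [c [g [a0 b0 eH]]]]] _ _ H'H eG]]]|].
  have /esym := congr1 (fun F => pm_comp F H) eG.
  rewrite pm_compA H'H pm_comp_idr eH !tri_comp !mulr1 !mul1r scale1r -aff1.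
  move=> /tri_inj[_ eg _ ec].
  by exists a, b, c, g; split=> //; apply: (addrI c); rewrite -ec addrC.
move=> [a [b [c [g [a0 b0 ed eg]]]]].
have [HH' H'H] := tri_inverse a g b c a0 b0.
set H := tri a g b c in HH' H'H; set H' := tri _ _ _ _ in HH' H'H.
exists H, H'; split=> //.
- by apply/BA2P; exists a, b, c, g.
- apply/BA2P; exists a^-1, b^-1, (- (b^-1 * c)); eexists.
  by rewrite !invr_eq0; split.
rewrite (_ : pm_comp H _ = pm_comp (tri 1 f' 1 d') H).
  by rewrite pm_compA HH' pm_comp_idr.
by rewrite !tri_comp !mulr1 !mul1r scale1r -aff1 eg ed [b * d + c]addrC.
Qed.

Lemma GA1_orbit_sym f g : GA1_orbit f g -> GA1_orbit g f.
Proof.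
move=> [_ [b [c [b0 ->]]] ->]; exists (aff b^-1 (- (b^-1 * c))).
  by exists b^-1, (- (b^-1 * c)); rewrite invr_eq0.
by rewrite -comp_polyA aff_comp_inv // comp_polyXr.
Qed.

End Triangular.

(** * The difference operator on k[y] and a complement of its image *)

Section Difference.
Context {k : fieldType}.
Implicit Types (c : k) (f g h : {poly k}).

Definition fdiff g : {poly k} := g \Po ('X + 1) - g.

Lemma fdiffD f g : fdiff (f + g) = fdiff f + fdiff g.
Proof. by rewrite /fdiff comp_polyD opprD addrACA. Qed.

Lemma fdiffZ c g : fdiff (c *: g) = c *: fdiff g.
Proof. by rewrite /fdiff comp_polyZ scalerBr. Qed.

Lemma coef_X1_exp m n : (('X + 1 : {poly k}) ^+ m)`_n = 'C(m, n)%:R.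
Proof.
elim: m n => [|m IHm] [|n]; rewrite ?expr0 ?coef1 //.
- by rewrite exprS mulrDl mul1r coefD coefXM IHm !bin0 add0r.
- by rewrite exprS mulrDl mul1r coefD coefXM !IHm binS natrD addrC.
Qed.

(** Under the size bound, only y^m and y^(m+1) contribute to degree [m] of g(y + 1). The first
    contribution cancels against [g], and the second carries the binomial coefficient C(m+1, m). *)
Lemma coef_fdiff g m : (size g <= m.+2)%N ->
  (fdiff g)`_m = m.+1%:R * g`_m.+1.
Proof.
move=> sg; rewrite coefB.
rewrite /comp_poly (@horner_coef_wide _ m.+2); last first.
  by rewrite (leq_trans (size_poly _ _)).
rewrite coef_sum !big_ord_recr big1 /= ?add0r => [|i _].
  rewrite !coef_map /= !coefCM !coef_X1_exp binn mulr1 binSn.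
  by rewrite addrAC subrr add0r mulrC.
by rewrite coef_map coefCM coef_X1_exp bin_small ?mulr0.
Qed.

Lemma size_fdiff g m : (size g <= m.+1)%N -> (size (fdiff g) <= m)%N.
Proof.
move=> sg; apply/leq_sizeP => j mj; rewrite coef_fdiff.
  by rewrite nth_default ?mulr0 // (leq_trans sg).
by rewrite (leq_trans sg) // ltnS (leq_trans mj).
Qed.

Context (p : nat) (charkp : p \in [pchar k]).
Let p_gt0 : (0 < p)%N := prime_gt0 (pcharf_prime charkp).

Definition residue h : {poly k} := 'X^(p.-1) * (h \Po 'X^p).

Lemma residueD f g : residue (f + g) = residue f + residue g.
Proof. by rewrite /residue comp_polyD mulrDr. Qed.

Lemma residueZ c g : residue (c *: g) = c *: residue g.
Proof. by rewrite /residue comp_polyZ scalerAr. Qed.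

(** The degree is (p - 1) + p deg h, and the size exceeds it by one. The resulting divisibility by
    [p] is what distinguishes residues from nonzero differences. *)
Lemma size_residue h : h != 0 -> size (residue h) = (p * size h)%N.
Proof.
move=> h0; have hp0 : h \Po 'X^p != 0.
  by rewrite -lead_coef_eq0 lead_coef_comp ?size_polyXn //
     lead_coefXn expr1n mulr1 lead_coef_eq0.
rewrite /residue size_monicM ?monicXn // size_polyXn (polySpred hp0).
rewrite size_comp_poly size_polyXn prednK // addnS /=.
by rewrite [in RHS](polySpred h0) mulnS mulnC.
Qed.

(** By additivity of Frobenius, (y + 1)^p = y^p + 1, so y^p - y is invariant under y -> y + 1. *)
Lemma pcharf_fixed_fdiff n : fdiff (('X^p - 'X) ^+ n) = 0.
Proof.
have chp : p \in [pchar {poly k}] by rewrite pchar_poly.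
rewrite /fdiff rmorphXn rmorphB rmorphXn /= comp_polyX.
rewrite -(pFrobenius_autE chp) pFrobenius_autD_comm; last exact: commr1.
by rewrite pFrobenius_aut1 pFrobenius_autE opprD addrACA subrr addr0 subrr.
Qed.

(* Differences kill the powers of [X^p - X], so the leading term of [g] may be
   assumed of degree prime to [p]; it then drops by exactly one. *)
Lemma fdiff_dvd_size_eq0 g : (p %| size (fdiff g))%N -> fdiff g = 0.
Proof.
have [n] := ubnP (size g); elim: n g => // n IHn g; rewrite ltnS => sg psz.
case: n sg IHn => [|n] sg IHn.
  move: sg; rewrite leqn0 size_poly_eq0 /fdiff => /eqP->.
  by rewrite comp_poly0 subrr.
have [/dvdnP[q nE]|pn] := boolP (p %| n)%N.
  pose u := ('X^p - 'X : {poly k}) ^+ q.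
  have sX : (size (- 'X : {poly k}) < size ('X^p : {poly k}))%N.
    rewrite size_polyN size_polyX size_polyXn ltnS.
    exact: prime_gt1 (pcharf_prime charkp).
  have um : u \is monic.
    by rewrite monic_exp // monicE lead_coefDl // lead_coefXn.
  have su : size u = n.+1.
    rewrite -(prednK (_ : 0 < size u)%N) ?size_poly_gt0 ?monic_neq0 //.
    by rewrite size_exp size_polyDl // size_polyXn nE mulnC.
  have eg : fdiff (g - g`_n *: u) = fdiff g.
    by rewrite -scaleNr fdiffD fdiffZ pcharf_fixed_fdiff scaler0 addr0.
  rewrite -eg; apply: IHn; rewrite ?eg //.
  rewrite ltnS; apply/leq_sizeP => j; rewrite leq_eqVlt => /orP[/eqP<-|nj].
    have := monicP um; rewrite lead_coefE su /= coefB coefZ => ->.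
    by rewrite mulr1 subrr.
  rewrite coefB coefZ (nth_default _ (leq_trans sg nj)).
  by rewrite (nth_default _ (_ : size u <= j)%N) ?su // mulr0 subrr.
case: n sg IHn pn => [|n] sg IHn pn; first by rewrite dvdn0 in pn.
have [gn0|gn0] := eqVneq g`_n.+1 0.
  apply: IHn => //; rewrite ltnS; apply/leq_sizeP => j.
  rewrite leq_eqVlt => /orP[/eqP<-//|nj].
  by rewrite nth_default // (leq_trans sg).
(* The coefficient of degree [n] in the difference is [n.+1] times a nonzero scalar, and [p] does
   not divide [n.+1]. The size is therefore exactly [n.+1], contradicting its divisibility by
   [p]. *)
suff s : size (fdiff g) = n.+1 by rewrite -s psz in pn.
apply/eqP; rewrite eqn_leq size_fdiff //= ltnNge.
apply/negP=> /leq_sizeP/(_ n (leqnn n))/eqP.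
by apply/negP; rewrite coef_fdiff // mulf_neq0 // -(dvdn_pcharf charkp).
Qed.

(** Induction on the size: the top term is removed by a residue or by a difference, according to
    whether its degree is congruent to -1 modulo [p]. *)
Lemma fdiff_residue_decomposition f : exists g h, f = fdiff g + residue h.
Proof.
have [n] := ubnP (size f); elim: n f => // n IHn f; rewrite ltnS => sf.
case: n sf IHn => [|n] sf IHn.
  exists 0, 0; move: sf; rewrite leqn0 size_poly_eq0 => /eqP->.
  by rewrite /fdiff /residue !comp_poly0 mulr0 subrr addr0.
suff [g [h [s e]]] : exists g h,
    (size (fdiff g + residue h)%R <= n.+1)%N /\ (fdiff g + residue h)`_n = f`_n.
  have [|g' [h' e']] := IHn (f - (fdiff g + residue h)).
    rewrite ltnS; apply/leq_sizeP => j; rewrite leq_eqVlt => /orP[/eqP<-|nj].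
      by rewrite coefB e subrr.
    by rewrite coefB !nth_default ?subrr // (leq_trans _ nj).
  exists (g' + g), (h' + h); rewrite fdiffD residueD addrACA -e'.
  by rewrite subrK.
have [/dvdnP[[//|q] nE]|pn] := boolP (p %| n.+1)%N.
  (* Here n + 1 = (q + 1)p, so n = (p - 1) + pq and y^n is the residue of y^q. *)
  exists 0, (f`_n *: 'X^q).
  rewrite /fdiff comp_poly0 subrr add0r residueZ.
  have -> : residue 'X^q = 'X^n.
    rewrite /residue comp_Xn_poly -exprM -exprD; congr ('X^ _).
    by apply: succn_inj; rewrite -addSn prednK // nE mulSn mulnC.
  rewrite coefZ coefXn eqxx mulr1; split=> //.
  by rewrite (leq_trans (size_scale_leq _ _)) // size_polyXn.
(* A discrete antiderivative of the top term: the difference of y^(n+1) has leading term (n + 1)y^n,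
   and n + 1 is invertible in [k]. *)
exists ((f`_n / n.+1%:R) *: 'X^(n.+1)), 0.
have sz : (size ((f`_n / n.+1%:R) *: 'X^(n.+1) : {poly k})%R <= n.+2)%N.
  by rewrite (leq_trans (size_scale_leq _ _)) // size_polyXn.
rewrite /residue comp_poly0 mulr0 addr0 size_fdiff // coef_fdiff //.
rewrite coefZ coefXn eqxx mulr1 mulrC divfK // -(dvdn_pcharf charkp) //.
Qed.

End Difference.

(** * Normal forms: separation of the four types and existence *)

Section NormalForms.
Context {k : fieldType} (p : nat) (charkp : p \in [pchar k]).
Context (R : {poly k} -> Prop).

(** Gives all four types the common shape (x + f(y), y + d), so that they are told apart by [d] and
    by the vanishing of [f]. *)
Lemma normal_form_tri i N : normal_form p R i N -> exists d f,
  N = tri 1 f 1 d /\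
  match i with
  | 1 => d = 0 /\ f = 0
  | 2 => d = 1 /\ f = 0
  | 3 => d = 0 /\ f != 0
  | 4 => d = 1 /\ exists2 h, h != 0 & f = residue p h
  | _ => False
  end.
Proof.
case=> [||f f0 _ _|f f0 _].
- by exists 0, 0; rewrite /tri in_y0 !scale1r !addr0.
- by exists 1, 0; rewrite /tri in_y0 !scale1r !addr0.
- by exists 0, f; rewrite /tri !scale1r !addr0.
- exists 1, (residue p f); rewrite /tri !scale1r; split=> //; split=> //.
  by exists f.
Qed.

(** The vanishing of [d] is invariant because d' = bd. For d = 0 the vanishing of [f] is invariant
    too, and for d = 1 a nonzero residue, even after an affine substitution or scaling, is not a
    difference. *)
Lemma normal_form_conj_index i j M N :
  normal_form p R i M -> normal_form p R j N -> BA2_conj M N -> i = j.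
Proof.
move=> /normal_form_tri[d [f [-> Hi]]] /normal_form_tri[d' [f' [-> Hj]]].
move=> /BA2_conj_tri[a [b [c [g [a0 b0 ed eg]]]]].
have saff (h : {poly k}) : size (h \Po aff b c) = size h.
  apply: size_comp_poly2.
  by rewrite /aff size_polyDl ?size_scale ?size_polyX // ltnS size_polyC leq_b1.
have affn0 (h : {poly k}) : h \Po aff b c = 0 -> h = 0.
  by move=> /eqP; rewrite -size_poly_eq0 saff size_poly_eq0 => /eqP.
have dd : (d == 0) = (d' == 0) by rewrite ed mulf_eq0 (negPf b0).
have resn0 (h : {poly k}) : h != 0 -> residue p h != 0.
  move=> h0; rewrite -size_poly_eq0 size_residue // muln_eq0 size_poly_eq0.
  by rewrite (negPf h0) -leqn0 leqNgt (prime_gt0 (pcharf_prime charkp)).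
have d0 : d = 0 -> a *: f = f' \Po aff b c.
  by move=> d0; move: eg; rewrite d0 addr0 comp_polyXr [RHS]addrC => /addIr.
have d1 : d = 1 -> fdiff g = f' \Po aff b c - a *: f.
  move=> d1; apply: (addrI (a *: f)); rewrite /fdiff -polyC1 -d1 addrA eg.
  by rewrite [g + _]addrC addrK addrC subrK.
case: i j Hi Hj => [|[|[|[|[|i]]]]] //= [|[|[|[|[|j]]]]] //=;
  move=> [ed1 ef] [ed1' ef'];
  try by move: dd; rewrite ed1 ed1' eqxx oner_eq0.
(* Comparing [d] leaves the pairs (1,3), (2,4), (3,1) and (4,2), in this order. In the second and
   fourth, [fdiff g] has size a multiple of [p], hence vanishes. *)
- by have := d0 ed1; rewrite ef scaler0 => /esym/affn0 e; rewrite e eqxx in ef'.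
- case: ef' => h h0 ef'; have e := d1 ed1; rewrite ef scaler0 subr0 in e.
  have := @fdiff_dvd_size_eq0 _ p charkp g.
  rewrite e saff ef' size_residue // dvdn_mulr // => /(_ isT)/affn0/eqP.
  by rewrite (negPf (resn0 _ h0)).
- have := d0 ed1; rewrite ef' comp_poly0 => /eqP.
  by rewrite scaler_eq0 (negPf a0) (negPf ef).
- case: ef => h h0 ef; have e := d1 ed1; rewrite ef' comp_poly0 sub0r in e.
  have := @fdiff_dvd_size_eq0 _ p charkp g.
  rewrite e size_polyN size_scale // ef size_residue // dvdn_mulr //.
  move=> /(_ isT)/eqP.
  by rewrite oppr_eq0 scaler_eq0 (negPf a0) (negPf (resn0 _ h0)).
Qed.

Lemma normal_form_exists F :
  GA1_representatives R -> monic_whenever_possible R -> BAs2 F ->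
  exists i N, normal_form p R i N /\ BA2_conj F N.
Proof.
move=> R_repr R_monic /BAs2P[d [f ->]].
have [->|d0] := eqVneq d 0.
  have [->|f0] := eqVneq f 0.
    exists 1%N, (pm_id k); split; first exact: NF1.
    rewrite -tri_id; apply/BA2_conj_tri; exists 1, 1, 0, 0.
    by rewrite oner_eq0 mulr0 !comp_poly0 scaler0.
  have lf0 : (lead_coef f)^-1 != 0 by rewrite invr_eq0 lead_coef_eq0.
  pose f1 := (lead_coef f)^-1 *: f.
  have f1m : f1 \is monic by rewrite monicE lead_coefZ mulVf // lead_coef_eq0.
  have [r [[Rr f1r] _]] := R_repr f1.
  (* Read in this direction, the orbit relation is f1 = r(by + c). It is what [R_monic] takes as
     input and also the conjugacy equation with g = 0. *)
  have rf1 := GA1_orbit_sym _ _ f1r.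
  have rm := R_monic _ _ Rr rf1 f1m.
  exists 3%N, (tri 1 r 1 0); split.
    rewrite /tri !scale1r addr0; exact: NF3 (monic_neq0 rm) rm Rr.
  case: rf1 => _ [b [c [b0 ->]]] e; apply/BA2_conj_tri.
  exists (lead_coef f)^-1, b, c, 0; split; rewrite ?mulr0 //.
  by rewrite comp_poly0 addr0 add0r.
(* Conjugation by (x, y/d) turns the translation y + d into y + 1 and f(y) into f(dy). *)
pose f1 := f \Po aff d 0.
have conj1 : BA2_conj (tri 1 f 1 d) (tri 1 f1 1 1).
  apply/BA2_conj_tri; exists 1, d^-1, 0, 0.
  split; rewrite ?oner_eq0 ?invr_eq0 ?mulVf //.
  rewrite comp_poly0 scale1r addr0 add0r -comp_polyA aff_comp divff //.
  by rewrite mulr0 addr0 aff10 comp_polyXr.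
have [g [h e]] := fdiff_residue_decomposition p charkp f1.
have [h0|h0] := eqVneq h 0.
  exists 2%N, (tri 1 0 1 1); split.
    rewrite /tri in_y0 !scale1r addr0; exact: NF2.
  (* Conjugation by (x - g(y), y) absorbs the difference part of [f1]. *)
  apply: BA2_conj_trans conj1 _; apply/BA2_conj_tri; exists 1, 1, 0, (- g).
  rewrite oner_eq0 mulr1; split=> //.
  rewrite comp_poly0 addr0 scale1r e h0 /residue comp_poly0 mulr0 addr0.
  by rewrite /fdiff linearN /= addrAC subrr add0r.
(* Conjugation by (ax - ag(y), y) removes the difference part and at the same time scales [h] to a
   monic polynomial. *)
pose a := (lead_coef h)^-1.
have a0 : a != 0 by rewrite invr_eq0 lead_coef_eq0.
exists 4%N, (tri 1 (residue p (a *: h)) 1 1); split.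
  rewrite /tri !scale1r; apply: NF4; first by rewrite scaler_eq0 negb_or a0.
  by rewrite monicE lead_coefZ mulVf // lead_coef_eq0.
apply: BA2_conj_trans conj1 _; apply/BA2_conj_tri; exists a, 1, 0, (- (a *: g)).
rewrite oner_eq0 mulr1 aff10 comp_polyXr residueZ; split=> //.
rewrite e /fdiff linearN linearZ /= !scalerDr scalerN.
by ring.
Qed.

End NormalForms.

Theorem corollary4p2 (k : fieldType) (p : nat) (charkp : p \in [pchar k])
    (R : {poly k} -> Prop)
    (R_repr : GA1_representatives R) (R_monic : monic_whenever_possible R) :
  (* the conjugacy classes are exactly those of the listed maps *)
  (forall C : polymap k -> Prop,
     (exists F, BAs2 F /\ (forall G, C G <-> conj_class F G)) <->
     (exists (i : nat) (N : polymap k),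
        normal_form p R i N /\ (forall G, C G <-> conj_class N G)))
  /\
  (* and the four types have no class in common *)
  (forall (i j : nat) (M N : polymap k),
     normal_form p R i M -> normal_form p R j N -> BA2_conj M N -> i = j).
Proof.
split=> [C|i j M N]; last exact: normal_form_conj_index.
split=> [[F [BF CF]]|[i [N [nN CN]]]].
  (* By symmetry and transitivity of conjugacy, [F] and its normal form [N] have the same class. *)
  have [i [N [nN FN]]] := normal_form_exists p charkp R F R_repr R_monic BF.
  exists i, N; split=> [//|G].
  split=> [/CF[BG conjG]|[BG conjG]]; last first.
    exact/CF/(conj BG (BA2_conj_trans _ _ _ FN conjG)).
  exact: conj BG (BA2_conj_trans _ _ _ (BA2_conj_sym _ _ FN) conjG).
exists N; split=> //; apply/BAs2P.
by have [d [f [-> _]]] := normal_form_tri p R i N nN; exists d, f.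
Qed.
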